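(* Let $n\ge 2$. Then $|\operatorname{Max}\mathcal{L}_n(3\underline{21})|=F_n$, where $F_n$ is the $n$th Fibonacci number.
   Context: Fibonacci numbers: $F_1=1$, $F_2=1$, $F_n=F_{n-1}+F_{n-2}$ for $n\ge 3$. $\mathcal{S}_n$ is the set of permutations $\pi=\pi_1\cdots\pi_n$ of $\{1,\dots,n\}$. The Lehmer code of $\pi\in\mathcal{S}_n$ is $L(\pi)=(p_1,\dots,p_n)$ with $p_i=|\{j>i:\pi_j<\pi_i\}|$. A permutation $\pi$ avoids the vincular pattern $3\underline{21}$ if there are no indices $i<j\le n-1$ with $\pi_i>\pi_j>\pi_{j+1}$. $\mathcal{L}_n(3\underline{21})$ is the set of Lehmer codes of all $3\underline{21}$-avoiding permutations in $\mathcal{S}_n$, partially ordered by $s\preceq t$ iff $s_i\le t_i$ for all $i$; $\operatorname{Max}\mathcal{L}_n(3\underline{21})$ is its set of maximal elements. *)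

(* Defs.v *)
From mathcomp Require Import all_boot all_fingroup.

Set Implicit Arguments.
Unset Strict Implicit.
Unset Printing Implicit Defensive.

(* Positions and values are numbered from 0 ('I_n) instead of from 1; all the
   notions below only depend on the relative order of positions and values
   and on adjacency of positions, so this shift is harmless. *)

(* fib 1 = fib 2 = 1; the value fib 0 = 0 is the usual extension. *)
Fixpoint fib (n : nat) : nat :=
  if n is n1.+1 then (if n1 is n2.+1 then fib n1 + fib n2 else 1) else 0.

Section Lehmer.

Variable n : nat.

Definition lehmer_entry (p : 'S_n) (i : 'I_n) : nat :=
  #|[set j : 'I_n | (i < j) && (p j < p i)]|.

Lemma lehmer_entry_lt (p : 'S_n) (i : 'I_n) : lehmer_entry p i < n.
Proof.
rewrite -[X in _ < X]card_ord -cardsT; apply: proper_card.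
by apply/properP; split; [apply: subsetT | exists i; rewrite !inE ?ltnn].
Qed.

(* The entries are bounded by n, so codes live in a finite type. *)
Definition code := {ffun 'I_n -> 'I_n}.

Definition lehmer (p : 'S_n) : code :=
  [ffun i => Ordinal (lehmer_entry_lt p i)].

(* p contains the vincular pattern 3-21 whose last two letters are adjacent:
   p i > p j > p k with i < j and k = j + 1. *)
Definition contains_3u21 (p : 'S_n) : bool :=
  [exists i : 'I_n, exists j : 'I_n, exists k : 'I_n,
     [&& i < j, k == j.+1 :> nat, p j < p i & p k < p j]].

Definition avoids_3u21 (p : 'S_n) : bool := ~~ contains_3u21 p.

Definition code_le (s t : code) : bool := [forall i, s i <= t i].

Definition maximal_codes (A : {set code}) : {set code} :=
  [set s in A | [forall t in A, code_le s t ==> (t == s)]].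

End Lehmer.

Definition lehmer_3u21 (n : nat) : {set code n} :=
  [set lehmer p | p : 'S_n & avoids_3u21 p].

(* Main.v *)
Require Import Defs.
From mathcomp Require Import all_boot all_fingroup.
From mathcomp Require Import zify.

Set Implicit Arguments.
Unset Strict Implicit.
Unset Printing Implicit Defensive.

(** A permutation avoids the pattern exactly when each descent top is a
    left-to-right maximum.  Hence the positions of its descents alone limit
    which pairs can be inverted, and the idea is to invert all the pairs that
    remain possible.

    Let [S] be a set of positions containing [0].  Declare the pair [i < v] to
    be inverted when [v] is not in [S] but some [k] in [S] has [i <= k < v].
    This is the inversion set of a permutation [block_perm S], in which the letters at [S]
    are the largest ones and increase, while the other letters form increasing
    runs, cut at [S], that are stacked in decreasing order.  It avoids the
    pattern, because the middle letter of an occurrence would have to lie both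
    outside [S] (being below an earlier letter) and inside [S] (being a
    descent top).

    Conversely, if [p] avoids the pattern and [S] consists of [0] and the
    descents of [p], then each inversion [i < v] of [p] is one of
    [block_perm S]: there is a descent between [i] and [v], and [v] itself is
    not a descent top.  So the code of [p] is below that of [block_perm S]
    ([lehmer_le_block_perm]).  The sets [S] that arise are sparse: they contain
    [0], omit the last position, and have no two consecutive positive elements.

    The codes of [block_perm S] for sparse [S] form an antichain
    ([sparse_antichain]), so they are precisely the maximal codes.  A sparse
    [S] is a word of length [n - 2] over the booleans without two consecutive
    [true], and there are [fib n] such words. *)

(** * Permutations from injective keys *)

Section Rank.

Variables (n : nat) (g : 'I_n -> nat).
Hypothesis g_inj : injective g.

Let below (i : 'I_n) := [set k : 'I_n | g k < g i].

Lemma rank_lt (i : 'I_n) : #|below i| < n.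
Proof.
rewrite -[X in _ < X]card_ord -cardsT; apply: proper_card.
by apply/properP; split; [apply: subsetT | exists i; rewrite !inE ?ltnn].
Qed.

Definition rank (i : 'I_n) : 'I_n := Ordinal (rank_lt i).

Lemma rank_mono i j : g i < g j -> rank i < rank j.
Proof.
move=> ltij; apply: proper_card; apply/properP; split.
  by apply/subsetP=> k; rewrite !inE => /ltn_trans; apply.
by exists i; rewrite !inE ?ltnn.
Qed.

Lemma rank_inj : injective rank.
Proof.
move=> i j eq_r; apply: g_inj.
by case: (ltngtP (g i) (g j)) => // /rank_mono; rewrite eq_r ltnn.
Qed.

Definition rank_perm : 'S_n := perm rank_inj.

Lemma rank_permE i j : (rank_perm i < rank_perm j) = (g i < g j).
Proof.
rewrite !permE; case: (ltngtP (g i) (g j)) => [/rank_mono //|/rank_mono|].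
  by move/ltnW; rewrite leqNgt => /negbTE.
by move/g_inj->; rewrite ltnn.
Qed.

End Rank.

(** * The permutation attached to a set of positions *)

Section Block.

Variables (n : nat) (S : pred nat).

Let later (i : 'I_n) := [set k : 'I_n | S k && (i <= k)].

(** Positions of [S] get the top level; the level of any other position drops
    each time an element of [S] is crossed.  Within a level, order is by
    position.  A level counts at most [n] elements, so [n.+1] is above them
    all. *)
Definition block_key (i : 'I_n) : nat :=
  (if S i then n.+1 else #|later i|) * n + i.

Lemma block_key_inj : injective block_key.
Proof.
move=> i j /(congr1 (modn^~ n)); rewrite !modnMDl !modn_small //.
exact: val_inj.
Qed.

Lemma block_key_lt (i v : 'I_n) : i < v ->
  (block_key v < block_key i) =
  ~~ S v && [exists k : 'I_n, [&& S k, i <= k & k < v]].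
Proof.
move=> lt_iv; rewrite /block_key.
have lev (j : 'I_n) : #|later j| * n + j < n.+1 * n.
  have : #|later j| <= n by rewrite -[X in _ <= X]card_ord max_card.
  by have := ltn_ord j; nia.
case: ifP => Sv /=; case: ifP => Si.
- by rewrite ltn_add2l ltnNge ltnW.
- by rewrite ltnNge (leq_trans (ltnW (lev i))) ?leq_addr.
- have -> : [exists k : 'I_n, [&& S k, i <= k & k < v]].
    by apply/existsP; exists i; rewrite Si leqnn.
  by rewrite (leq_trans (lev v)) ?leq_addr.
have sub : later v \subset later i.
  apply/subsetP=> k; rewrite !inE => /andP[-> /=].
  exact/leq_trans/ltnW.
case: existsP => [[k /and3P[Sk ik kv]]|nex].
  have lt_lev : #|later v| < #|later i|.
    apply/proper_card/properP; split=> //; exists k; rewrite !inE Sk ?ik //=.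
    by rewrite -ltnNge.
  apply: leq_trans (leq_trans (leq_mul lt_lev (leqnn n)) (leq_addr i _)).
  by rewrite mulSnr ltn_add2l.
suff -> : later i = later v by rewrite ltn_add2l ltnNge ltnW.
apply/eqP; rewrite eqEsubset sub andbT; apply/subsetP=> k.
rewrite !inE => /andP[Sk ik]; rewrite Sk /= leqNgt; apply/negP=> kv.
by apply: nex; exists k; rewrite Sk ik.
Qed.

Definition block_perm : 'S_n := rank_perm block_key_inj.

Definition block_inv (i : 'I_n) : {set 'I_n} :=
  [set v : 'I_n | [&& i < v, ~~ S v
                    & [exists k : 'I_n, [&& S k, i <= k & k < v]]]].

Lemma lehmer_block_perm i : lehmer block_perm i = #|block_inv i| :> nat.
Proof.
rewrite ffunE /=; apply: eq_card => v; rewrite !inE rank_permE.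
by case: ltnP => //= /block_key_lt.
Qed.

Lemma block_perm_avoids : avoids_3u21 block_perm.
Proof.
apply/existsP=> -[i /existsP[j /existsP[k /and4P[ij /eqP jk pij pjk]]]].
have ltjk : j < k by rewrite jk.
move: pij pjk; rewrite !rank_permE !block_key_lt // => /andP[Sj _].
case/andP=> _ /existsP[l /and3P[Sl jl]]; rewrite jk ltnS => lj.
by move: Sj; rewrite (_ : j = l) ?Sl //; apply/val_inj/anti_leq; rewrite jl.
Qed.

End Block.

(** * Every avoiding code lies below the code of a block permutation *)

Section Descents.

Variables (n : nat) (p : 'S_n).

Definition descent (k : nat) : bool :=
  [exists i : 'I_n, exists j : 'I_n,
    [&& i == k :> nat, j == k.+1 :> nat & p j < p i]].

Lemma descent_lt k : descent k -> k.+1 < n.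
Proof. by case/existsP=> i /existsP[j /and3P[_ /eqP <- _]]; apply: ltn_ord. Qed.

Lemma nodescent_leq (i v : 'I_n) : i <= v ->
  (forall k, i <= k < v -> ~~ descent k) -> p i <= p v.
Proof.
move=> le_iv; have [d def_d] : exists d, d = v - i by exists (v - i).
elim: d v le_iv def_d => [|d IHd] v le_iv def_d nodes.
  by rewrite (_ : i = v) //; apply/val_inj=> /=; lia.
have lt_un : v.-1 < n by have := ltn_ord v; lia.
pose u := Ordinal lt_un.
have le_iu : p i <= p u.
  apply: IHd => [||k /andP[ik ku]]; rewrite /=; try lia.
  by apply: nodes; rewrite /= in ku; lia.
apply: (leq_trans le_iu); rewrite leqNgt; apply/negP=> lt_vu.
have /negP[] : ~~ descent v.-1 by apply: nodes; lia.
apply/existsP; exists u; apply/existsP; exists v; rewrite /= eqxx lt_vu andbT.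
by apply/eqP; lia.
Qed.

Hypothesis p_av : avoids_3u21 p.

(** Otherwise [i], [j] and the position after [j] carry the pattern; so a
    descent top is a left-to-right maximum. *)
Lemma descent_max (i j : 'I_n) : i < j -> p j < p i -> ~~ descent j.
Proof.
move=> ij pij; apply/negP=> /existsP[j' /existsP[k /and3P[/eqP ej ek pk]]].
have {}ej : j' = j by apply: val_inj.
case/negP: p_av; apply/existsP; exists i; apply/existsP; exists j.
by apply/existsP; exists k; rewrite ij ek pij -ej.
Qed.

Lemma descent_sparse k : descent k -> ~~ descent k.+1.
Proof.
case/existsP=> i /existsP[j /and3P[/eqP ei /eqP ej pij]].
by rewrite -ej; apply: descent_max pij; rewrite ei ej.
Qed.

Lemma lehmer_le_block_perm (S : pred nat) :
  (forall k, S k = (k == 0) || descent k) ->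
  code_le (lehmer p) (lehmer (block_perm n S)).
Proof.
move=> defS; apply/forallP=> i; rewrite lehmer_block_perm ffunE /=.
apply/subset_leq_card/subsetP=> v; rewrite !inE => /andP[iv pvi].
rewrite iv defS negb_or (descent_max iv pvi) -lt0n (leq_ltn_trans _ iv) //=.
apply: contraLR pvi => /existsP nex; rewrite -leqNgt.
apply: nodescent_leq (ltnW iv) _ => k /andP[ik kv]; apply/negP=> dk.
have kn : k < n := ltn_trans kv (ltn_ord v).
by apply: nex; exists (Ordinal kn); rewrite defS dk orbT ik.
Qed.

End Descents.

(** * Sparse sets give an antichain of codes *)

(** Position [0] is exempt from the spacing condition: the first letter is a
    left-to-right maximum in any case, so [0] is always put in [S]. *)
Definition sparse (n : nat) (S : pred nat) : Prop :=
  [/\ S 0, forall k, S k -> k.+1 < n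
    & forall k, 0 < k -> S k -> ~~ S k.+1].

(** The comparison is decided at the largest position [m] where the two sets
    differ.  If [m] is in [S], the inversions of [m] for [T] are among those for
    [S], as both sets agree after [m], and sparseness makes [m.+1] an inversion
    of [m] for [S] only.  If [m] is in [T], then at the last element [a] of [S] before [m]
    all later positions outside [S] are inverted for [S], and among these [m]
    is lost for [T]. *)
Lemma sparse_antichain n (S T : pred nat) : sparse n S -> sparse n T ->
  code_le (lehmer (block_perm n S)) (lehmer (block_perm n T)) ->
  forall k, k < n -> S k = T k.
Proof.
move=> [S0 Slt Ssp] [T0 _ _] leST k0 k0n; apply/eqP/negPn/negP=> neq0.
have {}leST i : #|block_inv S i| <= #|block_inv T i :> {set 'I_n}|.
  by move/forallP/(_ i): leST; rewrite !lehmer_block_perm.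
case: (@arg_maxnP _ (Ordinal k0n) (fun m : 'I_n => S m != T m)
                  (@nat_of_ord n) neq0) => m neq_m max_m.
have agree (v : 'I_n) : m < v -> S v = T v.
  by move=> mv; apply/eqP/negPn/negP=> /max_m; rewrite /= leqNgt mv.
have m_gt0 : 0 < m.
  by rewrite lt0n; apply: contraNneq neq_m => ->; rewrite S0 T0.
suff [i] : exists i : 'I_n, block_inv T i \proper block_inv S i.
  by move/proper_card; rewrite ltnNge leST.
case Sm: (S m); move: neq_m; rewrite Sm eq_sym => Tm.
- exists m; apply/properP; split.
    apply/subsetP=> v; rewrite !inE => /and3P[mv Tv _].
    rewrite mv agree // Tv /=.
    by apply/existsP; exists m; rewrite Sm leqnn.
  exists (Ordinal (Slt _ Sm)); rewrite !inE /= ltnSn.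
    by rewrite Ssp //=; apply/existsP; exists m; rewrite Sm leqnn ltnSn.
  apply/negP=> /and3P[_ _ /existsP[k /and3P[Tk mk km]]].
  have ek : k = m by apply/val_inj/anti_leq; rewrite mk -ltnS km.
  by move: Tm; rewrite -ek Tk.
have n_gt0 : 0 < n := leq_ltn_trans (leq0n m) (ltn_ord m).
have P0 : S (Ordinal n_gt0) && (Ordinal n_gt0 < m) by rewrite /= S0.
case: (@arg_maxnP _ _ (fun a : 'I_n => S a && (a < m)) (@nat_of_ord n) P0).
move=> a /andP[Sa am] max_a; exists a.
have mem_inv (v : 'I_n) : a < v -> ~~ S v -> v \in block_inv S a.
  move=> av Sv; rewrite inE av Sv; apply/existsP; exists a.
  by rewrite Sa leqnn.
apply/properP; split; last first.
  exists m; first by rewrite mem_inv ?Sm.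
  by rewrite inE; case: (T m) Tm; rewrite ?andbF.
apply/subsetP=> v; rewrite inE => /and3P[av Tv _]; apply: mem_inv => //.
case: (ltngtP v m) => [vm|/agree-> //|/val_inj ->]; last by rewrite Sm.
by apply/negP=> Sv; have := max_a v; rewrite /= Sv vm leqNgt av => /(_ isT).
Qed.

(** * Counting sparse words *)

Definition spaced (a b : bool) : bool := ~~ (a && b).

Fixpoint sparse_words (m : nat) : seq bitseq :=
  if m is m1.+1 then
    map (cons false) (sparse_words m1) ++
    (if m1 is m2.+1 then map (fun w => [:: true, false & w]) (sparse_words m2)
     else [:: [:: true]])
  else [:: [::]].

Lemma sparse_wordsSS m : sparse_words m.+2 =
  map (cons false) (sparse_words m.+1) ++
  map (fun w => [:: true, false & w]) (sparse_words m).
Proof. by []. Qed.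

Lemma nat_ind2 (P : nat -> Prop) :
  P 0 -> P 1 -> (forall m, P m -> P m.+1 -> P m.+2) -> forall m, P m.
Proof.
by move=> P0 P1 PS m; suff [] : P m /\ P m.+1; elim: m => // m [? ?]; auto.
Qed.

Lemma size_sparse_words m : size (sparse_words m) = fib m.+2.
Proof.
elim/nat_ind2: m => // m IH0 IH1.
by rewrite sparse_wordsSS size_cat !size_map IH0 IH1.
Qed.

Lemma uniq_sparse_words m : uniq (sparse_words m).
Proof.
elim/nat_ind2: m => // m IH0 IH1.
rewrite sparse_wordsSS cat_uniq !map_inj_uniq ?IH0 ?IH1 => [|? ? []|? ? []] //.
rewrite andbT; apply/hasPn=> _ /mapP[w _ ->].
by apply/mapP=> -[].
Qed.

Lemma mem_sparse_words m w :
  (w \in sparse_words m) = (size w == m) && sorted spaced w.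
Proof.
have path_false s : path spaced false s = sorted spaced s by case: s.
elim/nat_ind2: m w => [|| m IH0 IH1] w; first by case: w.
  by rewrite !inE; case: w => [|[] [|[] []]].
have inj0 : injective (cons false) by move=> ? ? [].
have inj1 : injective (fun w => [:: true, false & w]) by move=> ? ? [].
rewrite sparse_wordsSS mem_cat; case: w => [|[] w].
- by apply/norP; split; apply/mapP=> -[].
- rewrite (_ : (true :: w \in map _ _) = false) /=; last first.
    by apply/negP=> /mapP[].
  case: w => [|[] w] /=; rewrite ?andbF; try by apply/mapP=> -[].
  by rewrite (mem_map inj1) IH0 path_false !eqSS.
rewrite (mem_map inj0) IH1 /= path_false eqSS orbC.
by rewrite (_ : (false :: w \in map _ _) = false) //; apply/negP=> /mapP[].
Qed.

(** The letters of a word of length [n - 2] stand for the positions from [1] to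
    [n - 2]; position [0] is always in the set, and the default value of [nth]
    keeps the last position out. *)
Definition word_set (w : bitseq) : pred nat := nth false (true :: w).

Lemma word_set_sparse n w : 1 < n -> w \in sparse_words n.-2 ->
  sparse n (word_set w).
Proof.
rewrite mem_sparse_words => n_gt1 /andP[/eqP sz_w w_sp].
have lt_size k : word_set w k.+1 -> k < size w.
  by rewrite ltnNge; apply: contraTN => le_k; rewrite /word_set /= nth_default.
split=> // [[|k] // /lt_size|[|k] // _ wk]; first lia.
apply/negP=> wk1; have := sortedP false w_sp k (lt_size _ wk1).
by rewrite /spaced; move: wk wk1; rewrite /word_set /= => -> ->.
Qed.

(** * The maximal codes *)

Lemma maximal_codes_antichain n (A C : {set code n}) :
    C \subset A ->
    (forall s, s \in A -> exists2 c, c \in C & code_le s c) ->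
    {in C &, forall c d, code_le c d -> c = d} ->
  maximal_codes A = C.
Proof.
move=> /subsetP subCA cover anti; apply/setP=> s; rewrite inE.
apply/andP/idP=> [[As /forallP max_s]|Cs].
  have [c Cc le_sc] := cover s As.
  by move: (max_s c); rewrite (subCA c Cc) le_sc => /eqP <-.
split; first exact: subCA.
apply/forallP=> t; apply/implyP=> At; apply/implyP=> le_st.
have [c Cc le_tc] := cover t At.
have le_sc : code_le s c.
  apply/forallP=> i.
  exact: leq_trans (forallP le_st i) (forallP le_tc i).
rewrite -(anti s c Cs Cc le_sc) in le_tc.
apply/eqP/ffunP=> i; apply/val_inj/anti_leq.
by rewrite (forallP le_st i) (forallP le_tc i).
Qed.

Theorem lemma4p8 (n : nat) (hn : 2 <= n) :
  #|maximal_codes (lehmer_3u21 n)| = fib n.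
Proof.
pose f w : code n := lehmer (block_perm n (word_set w)).
have f_le : {in sparse_words n.-2 &, forall w w',
    code_le (f w) (f w') -> w = w'}.
  move=> w w' Ww Ww' le_f.
  have eqS := sparse_antichain (word_set_sparse hn Ww)
                               (word_set_sparse hn Ww') le_f.
  move: Ww Ww'; rewrite !mem_sparse_words => /andP[/eqP sw _] /andP[/eqP sw' _].
  apply: (@eq_from_nth _ false); rewrite ?sw ?sw' // => k lt_k.
  by apply: (eqS k.+1); lia.
have f_inj : {in sparse_words n.-2 &, injective f}.
  by move=> w w' Ww Ww' eq_f; apply: f_le => //; rewrite eq_f; apply/forallP.
pose C := [set c in map f (sparse_words n.-2)].
have -> : maximal_codes (lehmer_3u21 n) = C.
  apply: maximal_codes_antichain.
  - apply/subsetP=> c; rewrite inE => /mapP[w _ ->].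
    by apply/imsetP; exists (block_perm n (word_set w));
      rewrite ?inE ?block_perm_avoids.
  - move=> s /imsetP[p]; rewrite inE => p_av ->.
    pose w := mkseq (fun k => descent p k.+1) n.-2.
    have defS k : word_set w k = (k == 0) || descent p k.
      case: k => //= k; case: (ltnP k n.-2) => [lt_k|le_k].
        by rewrite /word_set /= nth_mkseq.
      rewrite /word_set /= nth_default ?size_mkseq //; apply/esym/negbTE/negP.
      by move/descent_lt; lia.
    exists (f w); last exact: lehmer_le_block_perm.
    rewrite inE map_f // mem_sparse_words size_mkseq eqxx.
    apply/(sortedP false) => k; rewrite size_mkseq => lt_k.
    rewrite !nth_mkseq ?(ltnW lt_k) // /spaced; apply/negP=> /andP[dk].
    exact/negP/descent_sparse.
  move=> c d; rewrite !inE => /mapP[w Ww ->] /mapP[w' Ww' ->].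
  by move/f_le->.
rewrite cardsE (card_uniqP _) ?map_inj_in_uniq ?uniq_sparse_words //.
by rewrite size_map size_sparse_words; congr fib; lia.
Qed.
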